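(* Let $d\geq 3$. Then for every $\lambda\in\mathbb{C}$ the Laurent polynomial $z\mapsto\mathcal{P}(z,\lambda)$ is irreducible, i.e. there are no Laurent polynomials $f,g$ in $z=(z_1,\dots,z_d)$, neither of which is a monomial, such that $\mathcal{P}(\cdot,\lambda)=fg$.
   Context: Fix positive integers $q_1,\dots,q_d$ with greatest common divisor $1$, $Q=q_1\cdots q_d$, $\Gamma=q_1\mathbb{Z}\oplus\cdots\oplus q_d\mathbb{Z}$, and a $\Gamma$-periodic $V:\mathbb{Z}^d\to\mathbb{C}$. The discrete Laplacian is $(\Delta u)(n)=\sum_{\|n'-n\|_1=1}u(n')$. Let $W=\{n\in\mathbb{Z}^d:0\le n_j\le q_j-1\ \forall j\}$. For $z\in(\mathbb{C}\setminus\{0\})^d$, the space of functions $u:\mathbb{Z}^d\to\mathbb{C}$ with $u(n+q_je_j)=z_ju(n)$ for all $j,n$ is identified with $\mathbb{C}^W$ by restriction to $W$; $\mathcal{D}(z)$ denotes the $Q\times Q$ matrix of $-\Delta+V$ acting on this space. Set $\mathcal{P}(z,\lambda)=\det(\mathcal{D}(z)-\lambda I)$; it is a Laurent polynomial in $z_1,\dots,z_d$ and a polynomial in $\lambda$. A monomial is a Laurent polynomial of the form $Cz_1^{a_1}\cdots z_d^{a_d}$ with $C\neq 0$ constant and $a_j\in\mathbb{Z}$. *)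

(* Defs.v *)
From HB Require Import structures.
From mathcomp Require Import all_boot all_order all_algebra.
From mathcomp Require Import reals.
From mathcomp.real_closed Require Import complex.
Set Implicit Arguments. Unset Strict Implicit. Unset Printing Implicit Defensive.
Import Order.TTheory GRing.Theory Num.Theory.
Local Open Scope ring_scope.

Section Defs.
Variable R : realType.
Local Notation C := R[i].

Definition torus (d : nat) (z : 'I_d -> C) : Prop := forall j, z j != 0.

Definition zmon (d : nat) (z : 'I_d -> C) (a : 'I_d -> int) : C :=
  \prod_(j < d) z j ^ (a j).

Definition is_laurent (d : nat) (f : ('I_d -> C) -> C) : Prop :=
  exists (m : nat) (c : 'I_m -> C) (a : 'I_m -> 'I_d -> int),
    forall z, torus z -> f z = \sum_(k < m) c k * zmon z (a k).

Definition is_monomial (d : nat) (f : ('I_d -> C) -> C) : Prop :=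
  exists (c : C) (a : 'I_d -> int),
    c != 0 /\ forall z, torus z -> f z = c * zmon z a.

Definition cell (d : nat) (q : 'I_d -> nat) := {dffun forall j : 'I_d, 'I_(q j)}.

Definition cell_pt (d : nat) (q : 'I_d -> nat) (w : cell q) : 'I_d -> int :=
  fun j => (nat_of_ord (w j))%:Z.

Definition nbr (d : nat) (n : 'I_d -> int) (j : 'I_d) (b : bool) : 'I_d -> int :=
  fun i => n i + (if i == j then (if b then 1 else -1) else 0).

(* Entry (w, w') of the Floquet matrix D(z) of -Delta + V:
   (-Delta + V) u (w) = V(w) u(w) - sum_{n' ~ w} u(n'), and for
   n' = w' + (q_1 k_1, ..., q_d k_d) with w' in W, u(n') = z^k u(w'). *)
Definition floquet_entry (d : nat) (q : 'I_d -> nat) (V : ('I_d -> int) -> C)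
    (z : 'I_d -> C) (w w' : cell q) : C :=
  (if w == w' then V (cell_pt w) else 0)
  - \sum_(j < d) \sum_(b : bool)
      (let n' := nbr (cell_pt w) j b in
       if [forall i, (n' i %% (q i)%:Z)%Z == cell_pt w' i]
       then zmon z (fun i => ((n' i - cell_pt w' i) %/ (q i)%:Z)%Z)
       else 0).

Definition floquet_mx (d : nat) (q : 'I_d -> nat) (V : ('I_d -> int) -> C)
    (z : 'I_d -> C) : 'M[C]_(#|{: cell q}|) :=
  \matrix_(i, k) floquet_entry V z (enum_val i) (enum_val k).

Definition floquet_poly (d : nat) (q : 'I_d -> nat) (V : ('I_d -> int) -> C)
    (lam : C) (z : 'I_d -> C) : C :=
  \det (floquet_mx q V z - lam%:M).

End Defs.

(* Main.v *)
Require Import Defs.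
From HB Require Import structures.
From mathcomp Require Import all_boot all_order all_algebra.
From mathcomp Require Import perm separable cyclotomic.
From mathcomp Require Import boolp reals.
From mathcomp.real_closed Require Import complex.
From mathcomp Require Import ring zify.
Set Implicit Arguments. Unset Strict Implicit. Unset Printing Implicit Defensive.
Import Order.TTheory GRing.Theory Num.Theory.
Local Open Scope ring_scope.

(** Substitute z_j = w_j ^ q_j and conjugate D(z) by diag(w^n): the result is the
    potential minus the sum of the terms w_j^{+1} S_j + w_j^{-1} S_j^{-1}, with S_j
    the cyclic shifts.  Hence the Newton polytope of P in the variable w is Q times
    the cross polytope.  If P = f g, the polytopes of f and g are Minkowski
    summands of it; as d >= 3, they are translates of beta_f and beta_g times the
    cross polytope, with beta_f + beta_g = Q.  On the facet of exponents with
    largest sum, the leading part of P is det(- sum_j w_j S_j), which vanishes on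
    the hyperplane sum_j w_j = 0 because constants are in the kernel.  Hence the
    leading part of f, say, vanishes there and, being a function of z, on the
    images of this hyperplane under the q_j-th roots of unity.  These Q images are
    distinct since the q_j have gcd 1, so on a generic line parallel to an axis the
    leading part of f has Q distinct zeros.  Thus beta_f >= Q, beta_g <= 0, and g
    is a monomial. *)

(** * Polynomials and roots of unity *)

Lemma poly_nonroot (F : numFieldType) (p : {poly F}) :
  p != 0 -> exists2 t, t != 0 & p.[t] != 0.
Proof.
move=> p0; pose rs := [seq (k.+1%:R : F) | k <- iota 0 (size p)].
have urs : uniq rs.
  rewrite map_inj_uniq ?iota_uniq // => i j /eqP.
  by rewrite eqr_nat => /eqP[].
have [/allP h|] := boolP (all (root p) rs).
  have := max_poly_roots p0 (introT allP h) urs.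
  by rewrite size_map size_iota ltnn.
move=> /allPn[t /mapP[k _ ->] nr]; exists k.+1%:R => //.
by rewrite pnatr_eq0.
Qed.

Lemma poly_eq_nonzero (F : numFieldType) (p r : {poly F}) :
  (forall t, t != 0 -> p.[t] = r.[t]) -> p = r.
Proof.
move=> h; apply/eqP; rewrite -subr_eq0; apply/negPn/negP => /poly_nonroot[t t0].
by rewrite !hornerE h // subrr eqxx.
Qed.

(** An identity off the origin compares orders of vanishing at [t = 0]. Moving the power of [t] to
    the side where its exponent is positive gives an identity of polynomials, which then holds at
    [0] too. *)
Lemma poly_shift_origin (F : numFieldType) (p r : {poly F}) (k : int) :
  (forall t, t != 0 -> p.[t] * t ^ k = r.[t]) ->
  [/\ 0 < k -> r.[0] = 0, k < 0 -> p.[0] = 0 & k = 0 -> p.[0] = r.[0]].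
Proof.
move=> h; case: (intP k) h => [|n|n] h; split => //.
- by move=> _; congr (_.[0]); apply: poly_eq_nonzero => t t0; rewrite -h // mulr1.
- move=> _; have <- : p * 'X^(n.+1) = r.
    by apply: poly_eq_nonzero => t t0; rewrite -h // !hornerE.
  by rewrite !hornerE expr0n mulr0.
- move=> _; have -> : p = r * 'X^(n.+1).
    apply: poly_eq_nonzero => t t0; rewrite !hornerE -h // -exprnN -mulrA.
    by rewrite mulVf ?mulr1 // expf_neq0.
  by rewrite !hornerE expr0n mulr0.
Qed.

Lemma unity_roots_exist (F : numClosedFieldType) n : (0 < n)%N ->
  exists rs : seq F, [/\ size rs = n, uniq rs & forall x, x \in rs -> x ^+ n = 1].
Proof.
move=> n0; have [rs def] := closed_field_poly_normal ('X^n - 1 : {poly F}).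
have mon : ('X^n - 1 : {poly F}) \is monic by rewrite monicXnsubC.
rewrite (monicP mon) scale1r in def; exists rs; split.
- by apply: succn_inj; rewrite -(size_prod_XsubC rs id) -def size_XnsubC.
- rewrite -separable_prod_XsubC -def separable_Xn_sub_1 //.
  by rewrite pnatr_eq0 -lt0n.
- move=> x; rewrite -root_prod_XsubC -def => /rootP.
  by rewrite !hornerE => /eqP; rewrite subr_eq0 => /eqP.
Qed.

(** By Bezout, the exponents that send [x] to [1] are closed under gcd. *)
Lemma expr_biggcdn (F : fieldType) d (q : 'I_d -> nat) (x : F) : x != 0 ->
  (forall j, x ^+ q j = 1) -> x ^+ (\big[gcdn/0%N]_(j < d) q j) = 1.
Proof.
move=> x0 h; elim/big_ind: _ => // m n hm hn.
have [->|m0] := posnP m; first by rewrite gcd0n.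
have [u v e _] := egcdnP n m0.
have := congr1 (fun k => x ^+ k) e; rewrite exprD (mulnC u) (mulnC v) !exprM.
by rewrite hm hn !expr1n mul1r.
Qed.

(** * Laurent functions on the torus *)

Lemma exprz_inj_nneg (F : numFieldType) (x : F) (a b : int) :
  0 <= x -> x != 0 -> x != 1 -> x ^ a = x ^ b -> a = b.
Proof.
move=> x0 xn0 x1 e.
have : x ^ (a - b) = 1 by rewrite expfzDr // e -expfzDr // subrr.
suff E k : x ^ k = 1 -> k = 0 by move=> /E /eqP; rewrite subr_eq0 => /eqP.
have E n : x ^+ n == 1 -> n = 0%N.
  by rewrite pexprn_eq1 // (negbTE x1) orbF => /eqP.
case: (intP k) => // n h; last first.
  by move/eqP: h; rewrite -exprnN invr_eq1 => /E.
by move/eqP: h => /E.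
Qed.

Section Torus.
Variables (R : realType) (d : nat).
Local Notation C := R[i].
Local Notation point := ('I_d -> C).
Local Notation X := {ffun 'I_d -> int}.

Lemma zmon_neq0 (z : point) a : torus z -> zmon z a != 0.
Proof. by move=> tz; apply/prodf_neq0 => j _; rewrite expfz_neq0. Qed.

Lemma zmonM (z w : point) a : zmon (fun j => z j * w j) a = zmon z a * zmon w a.
Proof. by rewrite -big_split; apply: eq_bigr => j _; rewrite expfzMl. Qed.

Lemma torusM (z w : point) : torus z -> torus w -> torus (fun j => z j * w j).
Proof. by move=> tz tw j; rewrite mulf_neq0. Qed.

Definition affine_line (x y : point) (s : C) : point :=
  fun j => x j + s * (y j - x j).

Lemma affine_line0 x y : affine_line x y 0 = x.
Proof. by apply: funext => j; rewrite /affine_line mul0r addr0. Qed.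

Lemma affine_line1 x y : affine_line x y 1 = y.
Proof. by apply: funext => j; rewrite /affine_line mul1r subrKC. Qed.

Definition line_poly (x y : point) j : {poly C} := (x j)%:P + (y j - x j) *: 'X.

Lemma horner_line_poly x y j s : (line_poly x y j).[s] = affine_line x y s j.
Proof. by rewrite !hornerE mulrC. Qed.

Lemma torus_prod (z : point) : torus z <-> \prod_j z j != 0.
Proof.
split=> [tz|/prodf_neq0 h j]; last exact: h.
by apply/prodf_neq0 => j _.
Qed.

(** A substitute for regular functions on the torus: on every affine line, a power of the product of
    the coordinates clears the denominators. Nonvanishing arguments thus reduce to polynomials in
    one variable. *)
Definition line_regular (f : point -> C) : Prop :=
  forall x y, exists (p : {poly C}) (N : nat), forall s,
    torus (affine_line x y s) ->
    f (affine_line x y s) * (\prod_j affine_line x y s j) ^+ N = p.[s].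

Lemma line_regular_cst c : line_regular (fun=> c).
Proof. by move=> x y; exists c%:P, 0%N => s _; rewrite hornerC mulr1. Qed.

Lemma line_regularM f g :
  line_regular f -> line_regular g -> line_regular (fun z => f z * g z).
Proof.
move=> hf hg x y; have [p [N hp]] := hf x y; have [r [M hr]] := hg x y.
exists (p * r), (N + M)%N => s ts; rewrite hornerM -hp // -hr // exprD.
by rewrite mulrACA.
Qed.

Lemma line_regularD f g :
  line_regular f -> line_regular g -> line_regular (fun z => f z + g z).
Proof.
move=> hf hg x y; have [p [N hp]] := hf x y; have [r [M hr]] := hg x y.
exists (p * (\prod_j line_poly x y j) ^+ M + r * (\prod_j line_poly x y j) ^+ N).
exists (N + M)%N => s ts.
rewrite !(hornerE, horner_exp, horner_prod) -hp // -hr //.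
rewrite (eq_bigr _ (fun j _ => horner_line_poly x y j s)) exprD.
by rewrite mulrDl mulrA; congr (_ + _); rewrite -!mulrA [_ ^+ M * _]mulrC.
Qed.

Lemma line_regular_sum (I : Type) (r : seq I) (F : I -> point -> C) :
  (forall i, line_regular (F i)) ->
  line_regular (fun z => \sum_(i <- r) F i z).
Proof.
move=> h; elim: r => [|i r IH].
  have -> : (fun z => \sum_(i <- [::]) F i z) = (fun=> 0).
    by apply: funext => z; rewrite big_nil.
  exact: line_regular_cst.
have -> : (fun z => \sum_(i <- i :: r) F i z) =
          (fun z => F i z + \sum_(i <- r) F i z).
  by apply: funext => z; rewrite big_cons.
exact: line_regularD.
Qed.

Lemma line_regular_prod (I : Type) (r : seq I) (F : I -> point -> C) :
  (forall i, line_regular (F i)) ->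
  line_regular (fun z => \prod_(i <- r) F i z).
Proof.
move=> h; elim: r => [|i r IH].
  have -> : (fun z => \prod_(i <- [::]) F i z) = (fun=> 1).
    by apply: funext => z; rewrite big_nil.
  exact: line_regular_cst.
have -> : (fun z => \prod_(i <- i :: r) F i z) =
          (fun z => F i z * \prod_(i <- r) F i z).
  by apply: funext => z; rewrite big_cons.
exact: line_regularM.
Qed.

Lemma line_regular_coordX j (a : int) : line_regular (fun z => z j ^ a).
Proof.
move=> x y; case: (intP a) => [|n|n].
- by exists 1, 0%N => s _; rewrite hornerC mulr1.
- exists (line_poly x y j ^+ n.+1), 0%N => s _.
  by rewrite horner_exp horner_line_poly mulr1.
- exists ((\prod_(i | i != j) line_poly x y i) ^+ n.+1), n.+1 => s ts.
  rewrite horner_exp horner_prod (bigD1 j) //= exprMn -exprnN mulKf ?expf_neq0 //.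
  by congr (_ ^+ _); apply: eq_bigr => i _; rewrite horner_line_poly.
Qed.

(* Two functions that do not vanish identically on an affine subspace can be
   separated from zero simultaneously on the line joining the two witnesses:
   this plays the role of the integrality of the coordinate ring. *)
Lemma line_common_nonzero f g x y :
  line_regular f -> line_regular g -> torus x -> torus y ->
  f x != 0 -> g y != 0 ->
  exists s, [/\ torus (affine_line x y s), f (affine_line x y s) != 0
              & g (affine_line x y s) != 0].
Proof.
move=> hf hg tx ty fx gy; have [p [N hp]] := hf x y; have [r [M hr]] := hg x y.
pose l := \prod_j line_poly x y j.
have hl s : l.[s] = \prod_j affine_line x y s j.
  by rewrite horner_prod; apply: eq_bigr => j _; rewrite horner_line_poly.
have nz (u : {poly C}) s : u.[s] != 0 -> u != 0.
  by apply: contraNneq => ->; rewrite horner0.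
have p0 : p != 0.
  apply: (nz _ 0); rewrite -hp affine_line0 // mulf_neq0 // expf_neq0 //.
  exact/torus_prod.
have r0 : r != 0.
  apply: (nz _ 1); rewrite -hr affine_line1 // mulf_neq0 // expf_neq0 //.
  exact/torus_prod.
have l0 : l != 0 by apply: (nz _ 0); rewrite hl affine_line0; apply/torus_prod.
have [|s _] := @poly_nonroot C (p * r * l); first by rewrite !mulf_neq0.
rewrite !hornerM !mulf_eq0 !negb_or -andbA => /and3P[ps rs ls].
have ts : torus (affine_line x y s) by apply/torus_prod; rewrite -hl.
exists s; split=> //.
- by move: ps; rewrite -hp // mulf_eq0 negb_or => /andP[].
- by move: rs; rewrite -hr // mulf_eq0 negb_or => /andP[].
Qed.

Lemma common_nonzero (I : Type) (r : seq I) (F : I -> point -> C) :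
  (forall i, line_regular (F i)) ->
  (forall i, exists2 z, torus z & F i z != 0) ->
  exists2 z, torus z & \prod_(i <- r) F i z != 0.
Proof.
move=> reg nz; elim: r => [|i r [z tz hz]].
  by exists (fun=> 1) => [j|]; rewrite ?big_nil oner_neq0.
have [z' tz' hz'] := nz i.
have [s [ts h1 h2]] := line_common_nonzero (reg i) (line_regular_prod r reg)
                         tz' tz hz' hz.
by exists (affine_line z' z s); rewrite ?big_cons ?mulf_neq0.
Qed.

Definition power_point (q : 'I_d -> nat) (w : point) : point :=
  fun j => w j ^+ q j.

Lemma torus_power q w : torus w -> torus (power_point q w).
Proof. by move=> tw j; rewrite expf_neq0. Qed.

Lemma power_pointM q z w :
  power_point q (fun j => z j * w j) =
  (fun j => power_point q z j * power_point q w j).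
Proof. by apply: funext => j; rewrite /power_point exprMn. Qed.

Lemma zmon_power_sep q (v1 v2 : X) : (forall j, 0 < q j)%N -> v1 != v2 ->
  exists2 y : point, torus y & zmon (power_point q y) v1 != zmon (power_point q y) v2.
Proof.
move=> q0 v12; have /existsP[j vj] : [exists j, v1 j != v2 j].
  apply: contraNT v12 => /existsPn h; apply/eqP/ffunP => j.
  by apply/eqP; have := h j; rewrite negbK.
pose y : point := fun i => if i == j then 2 else 1.
exists y => [i|]; first by rewrite /y; case: ifP; rewrite ?pnatr_eq0 ?oner_neq0.
have E (v : X) : zmon (power_point q y) v = (2 ^+ q j) ^ v j.
  rewrite /zmon (bigD1 j) //= big1 ?mulr1 ?/power_point /y ?eqxx //.
  by move=> i /negbTE ->; rewrite expr1n exp1rz.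
rewrite !E; apply: contra vj => /eqP.
move=> e; apply/eqP; apply: (exprz_inj_nneg _ _ _ e).
- by rewrite exprn_ge0 ?ler0n.
- by rewrite expf_neq0 ?pnatr_eq0.
- by rewrite pexprn_eq1 ?ler0n // gtn_eqF //= pnatr_eq1.
Qed.

Definition laurent_eval (T : seq X) (c : X -> C) (z : point) : C :=
  \sum_(v <- T) c v * zmon z v.

Lemma line_regular_power q (T : seq X) c :
  line_regular (fun w => laurent_eval T c (power_point q w)).
Proof.
apply: line_regular_sum => v; apply: line_regularM.
  exact: line_regular_cst.
apply: line_regular_prod => j.
have -> : (fun w => power_point q w j ^ v j) = (fun w => w j ^ ((q j)%:Z * v j)).
  by apply: funext => w; rewrite -exprz_exp.
exact: line_regular_coordX.
Qed.

(** Linear independence of characters, by induction on the number of terms. *)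
Lemma laurent_eval_neq0 q (T : seq X) (c : X -> C) :
  (forall j, 0 < q j)%N -> uniq T -> T != [::] ->
  {in T, forall v, c v != 0} ->
  exists2 w, torus w & laurent_eval T c (power_point q w) != 0.
Proof.
move=> q0; have [n] := ubnP (size T); elim: n T c => // n IH [|v1 [|v2 T]] c //.
  move=> _ _ _ /(_ v1 (mem_head _ _)) cv.
  exists (fun=> 1) => [j|]; first exact: oner_neq0.
  rewrite /laurent_eval big_seq1 mulf_neq0 // zmon_neq0 // => j.
  by rewrite expf_neq0 ?oner_neq0.
move=> szT uT _ cT; apply: contrapT => none.
have zero w : torus w -> laurent_eval [:: v1, v2 & T] c (power_point q w) = 0.
  by move=> tw; apply/eqP/negPn/negP => h; apply: none; exists w.
have v12 : v1 != v2 by move: uT; rewrite /= inE negb_or => /andP[/andP[]].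
have [y ty hy] := zmon_power_sep q0 v12.
(* Translating a vanishing combination by [y] and subtracting [chi v1] times the original cancels
   the [v1] term, while the [v2] term survives by the choice of [y]. *)
pose chi (v : X) := zmon (power_point q y) v.
pose c' v := c v * (chi v - chi v1).
pose T' : seq X := [seq v <- v2 :: T | chi v != chi v1].
have [|||v|w tw /negP[]] := IH T' c'.
- by rewrite size_filter (leq_ltn_trans (count_size _ _)).
- by rewrite filter_uniq //; case/andP: uT.
- by rewrite /T' /= /chi (eq_sym (zmon _ v2)) hy.
- rewrite mem_filter => /andP[h vT]; rewrite mulf_neq0 ?subr_eq0 //.
  by apply: cT; rewrite inE vT orbT.
- have h1 := zero _ (torusM ty tw); have h2 := zero _ tw.
  have <- : laurent_eval [:: v1, v2 & T] c
       (power_point q (fun j => y j * w j)) - chi v1 *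
     laurent_eval [:: v1, v2 & T] c (power_point q w) =
     laurent_eval T' c' (power_point q w); last by rewrite h1 h2 mulr0 subr0.
  rewrite /laurent_eval mulr_sumr -sumrB power_pointM big_cons big_filter.
  rewrite [RHS]big_mkcond /= zmonM -/(chi v1) mulrCA subrr add0r.
  apply: eq_bigr => v _; rewrite zmonM -/(chi v).
  by case: eqP => [-> /=|_ /=]; rewrite /c'; ring.
Qed.

(** Equal exponents are collected and zero coefficients dropped, so [T] is exactly the support and
    its convex hull is the Newton polytope. *)
Lemma is_laurent_normal_form (f : point -> C) : is_laurent f ->
  exists (T : seq X) (c : X -> C),
    [/\ uniq T, {in T, forall v, c v != 0}
      & forall z, torus z -> f z = laurent_eval T c z].
Proof.
move=> [m [c0 [a0 hf]]].
pose b k : X := finfun (a0 k); pose c v := \sum_(k | b k == v) c0 k.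
exists [seq v <- undup (codom b) | c v != 0], c; split.
- by rewrite filter_uniq ?undup_uniq.
- by move=> v; rewrite mem_filter => /andP[].
move=> z tz; rewrite hf // /laurent_eval big_filter.
rewrite [RHS]big_mkcond /=.
transitivity (\sum_(v <- undup (codom b)) \sum_(k | b k == v) c0 k * zmon z (a0 k)).
  rewrite (exchange_big_dep xpredT) //=; apply: eq_bigr => k _.
  rewrite (eq_bigl (pred1 (b k))); last by move=> v; rewrite /= eq_sym.
  by rewrite -big_filter filter_pred1_uniq ?undup_uniq ?mem_undup ?codom_f // big_seq1.
apply: eq_bigr => v _.
have -> : \sum_(k | b k == v) c0 k * zmon z (a0 k) = c v * zmon z v.
  rewrite mulr_suml; apply: eq_bigr => k /eqP <-.
  by congr (_ * _); apply: eq_bigr => j _; rewrite ffunE.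
by case: eqP => //= ->; rewrite mul0r.
Qed.
End Torus.

(** * Minkowski summands of the cross polytope *)

Definition sgb (b : bool) : int := if b then 1 else -1.

Section Cone.
Variables (d : nat).
Local Notation X := {ffun 'I_d -> int}.

(** The cones over the facets of the cube, which are the maximal cones of the normal fan of the
    cross polytope. Support functions of its Minkowski summands are additive on each of them. *)
Definition in_cone (i : 'I_d) (b : bool) (x : X) := forall j, `|x j| <= sgb b * x i.

Definition signed_unit (i : 'I_d) (b : bool) : X :=
  [ffun j => if j == i then sgb b else 0].

Definition cone_additive (h : X -> int) := forall i b x y,
  in_cone i b x -> in_cone i b y -> h (x + y) = h x + h y.

Lemma third_index (i k : 'I_d) : (3 <= d)%N -> exists j, (j != i) && (j != k).
Proof.
move=> d3; have : (0 < #|~: [set i; k]|)%N.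
  have := cardsC [set i; k]; rewrite card_ord cards2; case: (i != k); lia.
by case/card_gt0P => j; rewrite !inE negb_or; exists j.
Qed.

Variable (h : X -> int).
Hypothesis (d3 : (3 <= d)%N) (hadd : cone_additive h).
Local Notation u := signed_unit.

(** The slope of [h] in the direction [sgb c] times the [k]-th unit vector, measured inside the cone
    of [(i, b)]. *)
Let step i b k c := h (u i b + u k c) - h (u i b).

Ltac cone_tac := let j := fresh "j" in
  move=> j; rewrite /signed_unit !ffunE /sgb ?eqxx;
  repeat match goal with |- context [j == ?y] =>
    let e := fresh "e" in have [e|e] := eqVneq j y; [rewrite ?e ?eqxx | rewrite ?(negbTE e)] end;
  repeat match goal with H : is_true (?x != ?y) |- _ =>
    rewrite ?(negbTE H) 1?[y == x]eq_sym ?(negbTE H); clear H end;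
  repeat match goal with b : bool |- _ => destruct b end; rewrite /=; lia.

Ltac h_lia := repeat match goal with |- context [h ?x] =>
  let y := fresh "y" in set y := h x; clearbody y end; clear; lia.

(** Both slopes equal the difference of [h] at [u i b + u k b' + u l c] and [u i b + u k b'],
    because these two points lie in both cones. *)
Lemma step_indep3 i k l b b' c : i != k -> i != l -> k != l ->
  step i b l c = step k b' l c.
Proof.
move=> ik il kl; rewrite /step.
have e1 : h (u i b + u k b') + h (u i b + u l c)
        = h (u i b) + h (u i b + u k b' + u l c).
  rewrite -(@hadd i b) -1?(@hadd i b); try cone_tac.
  by congr h; rewrite -!addrA; congr (_ + _); rewrite addrCA.
have e2 : h (u i b + u k b') + h (u k b' + u l c)
        = h (u k b') + h (u i b + u k b' + u l c).
  rewrite -(@hadd k b') -1?(@hadd k b'); try cone_tac.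
  by congr h; rewrite !addrA [u i b + u k b']addrC.
move: e1 e2; h_lia.
Qed.

Lemma step_indep i k l b b' c : i != l -> k != l -> step i b l c = step k b' l c.
Proof.
move=> il kl; case: (eqVneq i k) => [<-|ik]; last exact: step_indep3.
(* The cones of [(i, b)] and [(i, b')] may be opposite; both are compared with the cone of a third
   index. *)
have [j /andP[ji jl]] := third_index i l d3.
rewrite eq_sym in ji; have E b0 := @step_indep3 i j l b0 true c ji il jl.
by rewrite !E.
Qed.

Lemma stepN i l b c : i != l -> step i b l (~~ c) = - step i b l c.
Proof.
move=> il; rewrite /step.
have : h (u i b + u l c) + h (u i b + u l (~~ c)) = h (u i b) + h (u i b).
  rewrite -(@hadd i b) -1?(@hadd i b); try cone_tac.
  congr h; apply/ffunP => j; rewrite !ffunE.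
  by case: (j == l); case: c; rewrite /sgb /=; lia.
h_lia.
Qed.

(* The support function of a Minkowski summand of a multiple of the cross
   polytope is that of a translate of a multiple of the cross polytope: any two
   facets are joined by a chain of facets sharing triangles when [3 <= d]. *)
Lemma cone_additive_homothety : exists (mu : 'I_d -> int) (beta : int),
  (forall i b, h (u i b) = sgb b * mu i - beta) /\
  (forall i, h [ffun=> -1] - h ([ffun=> -1] + u i true + u i true) = - 2 * mu i).
Proof.
pose j0 : 'I_d := Ordinal (leq_trans (isT : (0 < 3)%N) d3).
have ne (k : 'I_d) : exists i, i != k by have [j /andP[? _]] := third_index k k d3; exists j.
pose o k := xchoose (ne k); have oP k : o k != k := xchooseP (ne k).
pose mu k := step (o k) true k true.
have stepE i k b c : i != k -> step i b k c = sgb c * mu k.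
  move=> ik; case: c; rewrite /sgb.
    by rewrite mul1r; apply: step_indep.
  by rewrite mulN1r -(@stepN _ _ _ true) //; apply: step_indep.
(* The vector [u i b + u k c] lies in both cones, so its value can be computed from either side. *)
have cst3 i k b c : i != k -> h (u i b) - sgb b * mu i = h (u k c) - sgb c * mu k.
  move=> ik; have := stepE i k b c ik; have := stepE k i c b.
  rewrite eq_sym ik => /(_ isT); rewrite /step [u k c + _]addrC; h_lia.
have cst i k b c : h (u i b) - sgb b * mu i = h (u k c) - sgb c * mu k.
  case: (eqVneq i k) => [<-|]; last exact: cst3.
  have [j /andP[ji _]] := third_index i i d3.
  by rewrite -(cst3 j i true b) // -(cst3 j i true c).
exists mu, (- (h (u j0 true) - sgb true * mu j0)); split=> [i b|i].
  by rewrite opprK -(cst i j0 b true) addrC subrK.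
set x : X := [ffun=> -1].
have ki := oP i; set k := o i in ki.
(* A parallelogram inside the cone of [(k, false)]; it turns the difference sought into a difference
   of two slopes along [i]. *)
have : h x + h (u k false + u i true) = h (x + u i true + u i true) + h (u k false + u i false).
  rewrite -(@hadd k false) -1?(@hadd k false) /x; try cone_tac.
  congr h; apply/ffunP => j; rewrite !ffunE.
  by case: (j == i); rewrite /sgb /=; lia.
have := stepE k i false true ki; have := stepE k i false false ki.
rewrite /step /sgb; h_lia.
Qed.
End Cone.

(** * The Floquet matrix in the variable w *)

Section Floquet.
Variables (R : realType) (d : nat) (q : 'I_d -> nat).
Hypothesis q0 : forall j, (0 < q j)%N.
Local Notation C := R[i].
Local Notation point := ('I_d -> C).
Local Notation N := #|{: cell q}|.


Lemma absz_modz_lt (x : int) j : (`|(x %% (q j)%:Z)%Z| < q j)%N.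
Proof.
have qj : (0 : int) < (q j)%:Z by rewrite ltz_nat.
by rewrite -ltz_nat gez0_abs ?modz_ge0 ?ltz_pmod ?gt_eqF.
Qed.

Definition cell_shift (w : cell q) j b : cell q :=
  finfun (fun i => Ordinal (absz_modz_lt (nbr (cell_pt w) j b i) i)).

Lemma cell_pt_shift w j b i :
  cell_pt (cell_shift w j b) i = (nbr (cell_pt w) j b i %% (q i)%:Z)%Z.
Proof.
rewrite /cell_pt ffunE /= gez0_abs ?modz_ge0 // gt_eqF // ltz_nat; exact: q0.
Qed.

Lemma cell_pt_inj (w w' : cell q) : cell_pt w =1 cell_pt w' -> w = w'.
Proof. by move=> h; apply/ffunP => j; apply/val_inj; case: (h j). Qed.

Lemma cell_shiftE (w w' : cell q) j b :
  [forall i, (nbr (cell_pt w) j b i %% (q i)%:Z)%Z == cell_pt w' i]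
  = (cell_shift w j b == w').
Proof.
apply/forallP/eqP => [h|<- i]; last by rewrite cell_pt_shift.
by apply: cell_pt_inj => i; rewrite cell_pt_shift; apply/eqP.
Qed.

Lemma cell_shift_inj j b : injective (fun w => cell_shift w j b).
Proof.
move=> w w' h; apply: cell_pt_inj => i.
have := congr1 (fun u => cell_pt u i) h; rewrite !cell_pt_shift /nbr => /eqP.
rewrite eqz_modDr => /eqP; rewrite !modz_small //=.
  by rewrite /cell_pt ltz_nat ltn_ord.
by rewrite /cell_pt ltz_nat ltn_ord.
Qed.

Lemma card_cell : N = (\prod_j q j)%N.
Proof. by rewrite card_dep_ffun foldrE big_map big_enum; apply: eq_bigr => j _; rewrite card_ord. Qed.

Variables (V : ('I_d -> int) -> C) (lam : C).

Definition hop (j : 'I_d) (b : bool) : 'M[C]_N :=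
  \matrix_(i, k) (cell_shift (enum_val i) j b == enum_val k)%:R.

Definition pot : 'M[C]_N :=
  diag_mx (\row_i (V (cell_pt (enum_val i)) - lam)).

(* The Floquet matrix at [z_j = w_j ^ q_j] minus [lam], conjugated by the diagonal
   matrix of the [w ^ n]. *)
Definition fiber_mx (w : point) : 'M[C]_N :=
  pot - \sum_j \sum_b (w j ^ sgb b) *: hop j b.

Lemma zmon_nbr (w : point) (n : 'I_d -> int) j b : torus w ->
  zmon w (nbr n j b) = w j ^ sgb b * zmon w n.
Proof.
move=> tw; rewrite /zmon (bigD1 j) //= [in RHS](bigD1 j) //= mulrA; congr (_ * _).
  by rewrite /nbr eqxx expfzDr // mulrC.
by apply: eq_bigr => i /negbTE ne; rewrite /nbr ne addr0.
Qed.

Lemma floquet_poly_power w : torus w ->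
  floquet_poly q V lam (power_point q w) = \det (fiber_mx w).
Proof.
move=> tw; pose e : 'rV[C]_N := \row_i zmon w (cell_pt (enum_val i)).
pose e' : 'rV[C]_N := \row_i (zmon w (cell_pt (enum_val i)))^-1.
have -> : \det (fiber_mx w) = \det (diag_mx e *m fiber_mx w *m diag_mx e').
  rewrite !det_mulmx !det_diag mulrAC -big_split /= big1 ?mul1r // => i _.
  by rewrite !mxE mulfV // zmon_neq0.
rewrite /floquet_poly; congr (\det _); apply/matrixP => i k.
rewrite mul_mx_diag mxE mul_diag_mx !mxE summxE /floquet_entry.
rewrite (inj_eq enum_val_inj).
have ek : zmon w (cell_pt (enum_val k)) != 0 by apply: zmon_neq0.
have -> : (if i == k then V (cell_pt (enum_val i)) else 0)
  = (V (cell_pt (enum_val i))) *+ (i == k) by case: (i == k).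
set S := \sum_(j < d) _; set S' := \sum_(j < d) _.
(* When the neighbour [n'] reduces to [w'] modulo the periods, each coordinate of [n' - w'] is a
   multiple of [q l], so [w ^ (n' - w')] is the monomial in [z] found in the Floquet entry. *)
have -> : S = zmon w (cell_pt (enum_val i)) * S' / zmon w (cell_pt (enum_val k)).
  rewrite /S /S' mulr_sumr mulr_suml; apply: eq_bigr => j _.
  rewrite summxE mulr_sumr mulr_suml; apply: eq_bigr => b _.
  rewrite !mxE -cell_shiftE; case: forallP => [h|_]; last by rewrite !(mulr0, mul0r).
  rewrite mulr1 [_ * _ ^ _]mulrC -zmon_nbr //.
  rewrite /zmon -prodf_div; apply: eq_bigr => l _.
  rewrite invr_expz -expfzDr // /power_point -(eqP (h l)).
  set m := nbr _ _ _ _.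
  have -> : m - (m %% (q l)%:Z)%Z = (m %/ (q l)%:Z)%Z * (q l)%:Z.
    by rewrite {1}(divz_eq m (q l)%:Z) addrK.
  rewrite mulzK; last by rewrite gt_eqF // ltz_nat.
  by rewrite mulrC -exprz_exp.
case: eqP => [->|_]; rewrite ?mulr1n ?mulr0n ?subr0 ?sub0r; last first.
  by rewrite mulrN mulNr.
by field.
Qed.

Definition scale_point (a : 'I_d -> int) (t : C) (w : point) : point :=
  fun j => t ^ a j * w j.

Lemma torus_scale a t w : t != 0 -> torus w -> torus (scale_point a t w).
Proof. by move=> t0 tw j; rewrite mulf_neq0 // expfz_neq0. Qed.

(** The absolute values make the exponents natural numbers; under [dominates m a] they leave
    [m + sgb b * a j] unchanged. *)
Definition scaled_mx (a : 'I_d -> int) (m : nat) (w : point) : 'M[{poly C}]_N :=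
  'X^m *: map_mx polyC pot
  - \sum_j \sum_b 'X^(`|m%:Z + sgb b * a j|) *: map_mx polyC ((w j ^ sgb b) *: hop j b).

(* The value at [t = 0] of [t ^ m] times [fiber_mx] at [scale_point a t w], of which
   [scaled_mx] is the polynomial in [t]. *)
Definition initial_mx (a : 'I_d -> int) (m : nat) (w : point) : 'M[C]_N :=
  - \sum_j \sum_(b | m%:Z + sgb b * a j == 0) (w j ^ sgb b) *: hop j b.

Definition dominates (m : nat) (a : 'I_d -> int) := forall j, `|a j| <= m%:Z.

Lemma horner_det n (A : 'M[{poly C}]_n) t :
  (\det A).[t] = \det (map_mx (horner_eval t) A).
Proof. by rewrite det_map_mx. Qed.

Lemma map_scaled_mx a m w t :
  map_mx (horner_eval t) (scaled_mx a m w) =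
  t ^+ m *: pot - \sum_j \sum_b (t ^+ `|m%:Z + sgb b * a j| * w j ^ sgb b) *: hop j b.
Proof.
have E n (A : 'M[C]_N) : map_mx (horner_eval t) ('X^n *: map_mx polyC A) = t ^+ n *: A.
  by apply/matrixP => i k; rewrite !mxE /horner_eval !hornerE.
rewrite /scaled_mx map_mxB E map_mx_sum; congr (_ - _); apply: eq_bigr => j _.
by rewrite map_mx_sum; apply: eq_bigr => b _; rewrite E scalerA.
Qed.

Lemma horner_det_scaled_mx a m w t : dominates m a -> torus w -> t != 0 ->
  (\det (scaled_mx a m w)).[t] =
  t ^ (m * N)%N * floquet_poly q V lam (power_point q (scale_point a t w)).
Proof.
move=> dom tw t0; rewrite floquet_poly_power; last exact: torus_scale.
rewrite horner_det map_scaled_mx -exprnP exprM -detZ; congr (\det _).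
rewrite /fiber_mx scalerBr; congr (_ - _).
rewrite scaler_sumr; apply: eq_bigr => j _; rewrite scaler_sumr.
apply: eq_bigr => b _; rewrite scalerA; congr (_ *: _).
rewrite /scale_point expfzMl mulrA; congr (_ * _).
have h : 0 <= m%:Z + sgb b * a j.
  by have := dom j; rewrite /sgb; case: b; lia.
have -> : t ^+ `|m%:Z + sgb b * a j| = t ^ (m%:Z + sgb b * a j).
  by rewrite -{2}(gez0_abs h).
rewrite expfzDr //; congr (_ * _).
by rewrite exprz_exp mulrC.
Qed.

Lemma horner0_det_scaled_mx a m w : (0 < m)%N ->
  (\det (scaled_mx a m w)).[0] = \det (initial_mx a m w).
Proof.
move=> m0; rewrite horner_det map_scaled_mx; congr (\det _).
rewrite expr0n eqn0Ngt m0 scale0r sub0r; congr (- _).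
apply: eq_bigr => j _; rewrite [RHS]big_mkcond; apply: eq_bigr => b _.
by rewrite expr0n absz_eq0; case: eqP; rewrite ?mul1r // mul0r scale0r.
Qed.

Lemma det_hop j b : \det (hop j b) != 0.
Proof.
have inj : injective (fun i : 'I_N => enum_rank (cell_shift (enum_val i) j b)).
  by move=> i k /enum_rank_inj /cell_shift_inj /enum_val_inj.
have -> : hop j b = perm_mx (perm inj).
  apply/matrixP => i k; rewrite !mxE permE.
  by rewrite -(inj_eq enum_val_inj) enum_rankK.
by rewrite det_perm signr_eq0.
Qed.

Lemma initial_mx_neq0 a m j0 : (0 < m)%N -> `|a j0| = m%:Z ->
  exists2 w, torus w & \det (initial_mx a m w) != 0.
Proof.
move=> m0 aj.
have [b0 hb0] : exists b0, m%:Z + sgb b0 * a j0 = 0.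
  have [h|h] := lerP 0 (a j0); [exists false | exists true]; rewrite /sgb; lia.
have hb b : (m%:Z + sgb b * a j0 == 0) = (b == b0).
  by case: b b0 hb0 => [] []; rewrite /sgb; lia.
pose K : 'M[C]_N := \sum_(j | j != j0)
  \sum_(b | m%:Z + sgb b * a j == 0) hop j b.
pose P : 'M[{poly C}]_N := map_mx polyC (hop j0 b0) + 'X *: map_mx polyC K.
have EP s : map_mx (horner_eval s) P = hop j0 b0 + s *: K.
  by apply/matrixP => i k; rewrite !mxE /horner_eval !hornerE.
have P0 : \det P != 0.
  apply: contraNneq (det_hop j0 b0) => h.
  by rewrite -[hop _ _]addr0 -(scale0r K) -EP -horner_det h horner0.
have [s s0] := poly_nonroot P0; rewrite horner_det EP => hs.
(* Chosen so that the surviving term in direction [j0] gets coefficient [s^-1] and all others [1]: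
   the initial matrix is then [- s^-1] times [hop j0 b0 + s *: K], a perturbation of a permutation
   matrix. *)
pose w : point := fun j => if j == j0 then s^-1 ^ sgb b0 else 1.
exists w => [j|].
  by rewrite /w; case: ifP; rewrite ?oner_neq0 // expfz_neq0 // invr_eq0.
have -> : initial_mx a m w = - s^-1 *: (hop j0 b0 + s *: K).
  rewrite /initial_mx (bigD1 j0) //= (eq_bigl _ _ hb) big_pred1_eq.
  rewrite /w eqxx exprz_exp scaleNr scalerDr scalerA mulVf // scale1r.
  congr (- (_ *: _ + _)); first by case: (b0).
  apply: eq_bigr => j /negbTE ->; apply: eq_bigr => b _.
  by rewrite exp1rz scale1r.
by rewrite detZ mulf_neq0 // expf_neq0 // oppr_eq0 invr_eq0.
Qed.

(** With all weights [-1] and [m = 1] only forward hops survive. Each fixes the constant vector, so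
    that vector is multiplied by [- \sum_j w j]. *)
Lemma initial_mx_singular w : \sum_j w j = 0 ->
  \det (initial_mx (fun=> -1) 1 w) = 0.
Proof.
move=> sw; apply/eqP/negPn/negP => h.
pose u : 'cV[C]_N := const_mx 1.
have hopu j b : hop j b *m u = u.
  apply/matrixP => i k; rewrite !mxE (bigD1 (enum_rank (cell_shift (enum_val i) j b))) //=.
  rewrite !mxE enum_rankK eqxx mulr1 big1 ?addr0 // => l ne.
  by rewrite !mxE -(inj_eq enum_rank_inj) enum_valK eq_sym (negbTE ne) mul0r.
have Mu : initial_mx (fun=> -1) 1 w *m u = 0.
  rewrite mulNmx mulmx_suml.
  have E j : (\sum_(b | 1%:Z + sgb b * -1 == 0) (w j ^ sgb b) *: hop j b) *m u = w j *: u.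
    by rewrite mulmx_suml big_mkcond big_bool /= addr0 -scalemxAl hopu.
  by rewrite (eq_bigr _ (fun j _ => E j)) -scaler_suml sw scale0r oppr0.
(* A point of the cell, where the constant vector takes the value [1] and so is not zero. *)
pose w0 : cell q := finfun (fun j => Ordinal (q0 j)).
have U : initial_mx (fun=> -1) 1 w \in unitmx by rewrite unitmxE unitfE.
have := mulKmx U u; rewrite Mu mulmx0 => /matrixP /(_ (enum_rank w0) 0).
by rewrite !mxE => /esym/eqP; rewrite oner_eq0.
Qed.
End Floquet.

(** * Initial forms *)

Section Newton.
Variables (R : realType) (d : nat) (q : 'I_d -> nat).
Local Notation C := R[i].
Local Notation point := ('I_d -> C).
Local Notation X := {ffun 'I_d -> int}.

(* The [a]-weight of the monomial [z ^ v] is measured in the variable [w], where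
   [z_j = w_j ^ q_j]. *)
Definition weight (a v : X) : int := \sum_j a j * ((q j)%:Z * v j).

Lemma weightD a b v : weight (a + b) v = weight a v + weight b v.
Proof. by rewrite -big_split; apply: eq_bigr => j _; rewrite ffunE mulrDl. Qed.

Lemma weight_unit i b v : weight (signed_unit i b) v = sgb b * ((q i)%:Z * v i).
Proof.
rewrite /weight (bigD1 i) //= ffunE eqxx big1 ?addr0 // => j /negbTE ne.
by rewrite ffunE ne mul0r.
Qed.

(** The support function of the Newton polytope, in the minimum convention. Starting the fold at the
    weight of the head makes the default harmless for nonempty [T]. *)
Definition min_weight (T : seq X) (a : X) : int :=
  foldr Order.min (weight a (head 0 T)) [seq weight a v | v <- T].

Lemma min_weight_le T a v : v \in T -> min_weight T a <= weight a v.
Proof.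
rewrite /min_weight; elim: T (weight a _) => // x T IH w; rewrite inE /= ge_min.
by case/orP => [/eqP->|/IH ->]; rewrite ?lexx ?orbT.
Qed.

Lemma min_weight_attained T a : T != [::] ->
  exists2 v, v \in T & weight a v = min_weight T a.
Proof.
case: T => // x T _.
suff: min_weight (x :: T) a \in [seq weight a v | v <- x :: T].
  by case/mapP => v vT ->; exists v.
have foldr_min w s : foldr Order.min w s \in (w : int) :: s.
  elim: s => [|y s IH] /=; first by rewrite mem_head.
  rewrite minElt; case: ifP => _; first by rewrite !inE eqxx orbT.
  by move: IH; rewrite !inE => /orP[->|->]; rewrite ?orbT.
have := foldr_min (weight a x) [seq weight a v | v <- x :: T].
by rewrite /min_weight [in head _ _]/= !inE orbA orbb.
Qed.

Lemma min_weight_superadditive T a b : T != [::] ->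
  min_weight T a + min_weight T b <= min_weight T (a + b).
Proof.
move=> /min_weight_attained -/(_ (a + b))[v vT <-].
by rewrite weightD lerD ?min_weight_le.
Qed.

Definition face (T : seq X) (a : X) : seq X :=
  [seq v <- T | weight a v == min_weight T a].

Definition initial_form (T : seq X) (c : X -> C) (a : X) (w : point) : C :=
  laurent_eval (face T a) c (power_point q w).

Lemma face_neq_nil T a : T != [::] -> face T a != [::].
Proof.
move=> /min_weight_attained -/(_ a)[v vT e]; rewrite -has_filter.
by apply/hasP; exists v; rewrite ?e.
Qed.

Lemma zmon_scale (a : X) (t : C) w (v : X) : t != 0 -> torus w ->
  zmon (power_point q (scale_point a t w)) v =
  t ^ weight a v * zmon (power_point q w) v.
Proof.
move=> t0 tw; rewrite /zmon /weight.
have -> : t ^ (\sum_j a j * ((q j)%:Z * v j)) = \prod_j t ^ (a j * ((q j)%:Z * v j)).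
  by elim/big_rec2: _ => [|j x y _ <-]; rewrite ?expr0z // expfzDr.
rewrite -big_split; apply: eq_bigr => j _.
by rewrite /= /power_point /scale_point exprMn expfzMl -!exprz_exp.
Qed.

(** The Laurent polynomial along the curve [scale_point a t w], divided by its lowest possible power
    of [t]; its constant term is the initial form. *)
Definition weight_poly (T : seq X) (c : X -> C) (a : X) (w : point) : {poly C} :=
  \sum_(v <- T) (c v * zmon (power_point q w) v) *: 'X^(`|weight a v - min_weight T a|).

Lemma horner0_weight_poly T c a w :
  (weight_poly T c a w).[0] = initial_form T c a w.
Proof.
rewrite /initial_form /laurent_eval big_filter [RHS]big_mkcond horner_sum.
apply: eq_bigr => v _; rewrite !hornerE expr0n absz_eq0 subr_eq0.
by case: eqP; rewrite ?mulr1 ?mulr0.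
Qed.

Lemma horner_weight_poly T c (a : X) w t : torus w -> t != 0 ->
  (weight_poly T c a w).[t] * t ^ min_weight T a =
  laurent_eval T c (power_point q (scale_point a t w)).
Proof.
move=> tw t0; rewrite horner_sum mulr_suml; apply: eq_big_seq => v vT.
have E : t ^+ `|weight a v - min_weight T a| * t ^ min_weight T a = t ^ weight a v.
  rewrite [t ^+ _](_ : _ = t ^ (weight a v - min_weight T a)).
    by rewrite -expfzDr // subrK.
  by rewrite -{2}[_ - _]gez0_abs // subr_ge0 min_weight_le.
rewrite zmon_scale // hornerZ hornerXn -E.
by move: (t ^+ _) (t ^ _) => x y; ring.
Qed.

Hypothesis q0 : forall j, (0 < q j)%N.
Variables (V : ('I_d -> int) -> C) (lam : C).
Local Notation N := (\prod_j q j)%N.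

(** If it vanished on the torus, the determinant of [scaled_mx] would vanish for all [t != 0], hence
    at [t = 0], against [initial_mx_neq0]. *)
Lemma floquet_poly_neq0 (j : 'I_d) :
  exists2 z, torus z & floquet_poly q V lam z != 0.
Proof.
pose a : X := signed_unit j true.
have aj : `|a j| = 1%:Z by rewrite ffunE eqxx.
have [w tw h] := initial_mx_neq0 R q0 (isT : (0 < 1)%N) aj.
apply: contrapT => none; case/negP: h; rewrite -(horner0_det_scaled_mx q0 V lam) //.
suff -> : \det (scaled_mx q0 V lam a 1 w) = 0 by rewrite horner0.
apply: poly_eq_nonzero => t t0; rewrite horner0 horner_det_scaled_mx //; last first.
  by move=> i; rewrite ffunE; case: eqP.
apply/eqP; rewrite mulf_eq0; apply/orP; right; apply/negPn/negP => h.
by apply: none; eexists; last exact: h; apply/torus_power/torus_scale.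
Qed.

Variables (S T : seq X) (b c : X -> C).
Hypotheses (uS : uniq S) (uT : uniq T) (S0 : S != [::]) (T0 : T != [::]).
Hypotheses (bS : {in S, forall v, b v != 0}) (cT : {in T, forall v, c v != 0}).
Hypothesis factor : forall z, torus z ->
  floquet_poly q V lam z = laurent_eval S b z * laurent_eval T c z.

Lemma line_regular_initial_form U (e : X -> C) a : line_regular (initial_form U e a).
Proof. exact: line_regular_power. Qed.

Lemma initial_form_neq0 U (e : X -> C) a :
  uniq U -> U != [::] -> {in U, forall v, e v != 0} ->
  exists2 w, torus w & initial_form U e a w != 0.
Proof.
move=> uU U0 eU; apply: laurent_eval_neq0 => //.
- by rewrite filter_uniq.
- exact: face_neq_nil.
- by move=> v; rewrite mem_filter => /andP[_ /eU].
Qed.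

(** Lowest powers of [t] are compared on both sides of the factorization. With [k] the discrepancy,
    [k > 0] would make the initial determinant vanish everywhere, and [k < 0] the product of the
    initial forms; neither happens. *)
Lemma initial_form_factor (a : X) m j0 : (0 < m)%N -> dominates m a ->
  `|a j0| = m%:Z ->
  min_weight S a + min_weight T a = - (m * N)%:Z /\
  forall w, torus w -> initial_form S b a w * initial_form T c a w
                       = \det (initial_mx q0 a m w : 'M[C]_#|{: cell q}|).
Proof.
move=> m0 dom aj; pose k := min_weight S a + min_weight T a + (m * N)%:Z.
have key w : torus w -> forall t, t != 0 ->
  (weight_poly S b a w * weight_poly T c a w).[t] * t ^ k
  = (\det (scaled_mx q0 V lam a m w : 'M[{poly C}]_#|{: cell q}|)).[t].
  move=> tw t t0; rewrite horner_det_scaled_mx // factor; last first.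
    exact/torus_power/torus_scale.
  rewrite -!horner_weight_poly // hornerM /k card_cell !expfzDr //.
  by move: (t ^ _) (t ^ _) (t ^ _) (_.[t]) (_.[t]) => *; ring.
have [w tw hw] := initial_mx_neq0 R q0 m0 aj.
suff k0 : k = 0.
  split; first by apply/eqP; rewrite -addr_eq0; apply/eqP.
  move=> u tu; have [_ _ /(_ k0)] := poly_shift_origin (key u tu).
  by rewrite hornerM !horner0_weight_poly horner0_det_scaled_mx.
have [x tx hx] := initial_form_neq0 a uS S0 bS.
have [y ty hy] := initial_form_neq0 a uT T0 cT.
have [s [ts h1 h2]] := line_common_nonzero (line_regular_initial_form _ _ _)
  (line_regular_initial_form _ _ _) tx ty hx hy.
have [h _ _] := poly_shift_origin (key _ tw).
have [_ h' _] := poly_shift_origin (key _ ts).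
case: (ltgtP k 0) => // hk.
  have := h' hk; rewrite hornerM !horner0_weight_poly => /eqP.
  by rewrite mulf_eq0 (negbTE h1) (negbTE h2).
by have := h hk; rewrite horner0_det_scaled_mx // => /eqP; rewrite (negbTE hw).
Qed.

Lemma min_weight0 U : U != [::] -> min_weight U 0 = 0.
Proof.
move=> /min_weight_attained -/(_ 0)[v _ <-].
by rewrite /weight big1 // => j _; rewrite ffunE mul0r.
Qed.

(** On the cone, [sgb s * a i] is the largest [|a j|], so the right-hand side is the support
    function of [N] times the cross polytope. *)
Lemma min_weight_sum i s (a : X) : in_cone i s a ->
  min_weight S a + min_weight T a = - (sgb s * a i * N%:Z).
Proof.
(* On the cone [a i = 0] forces [a = 0], which is treated apart because [initial_form_factor] asks
   for [0 < m]. *)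
move=> ca; have [ai0|ai0] := eqVneq (a i) 0.
  have -> : a = 0.
    apply/ffunP => j; rewrite ffunE; apply/eqP.
    by have := ca j; rewrite ai0 mulr0 normr_le0.
  by rewrite !min_weight0 // ffunE mulr0 mul0r.
have e : sgb s * a i = (`|a i|%N)%:Z.
  by move: (ca i); rewrite /sgb; move: (a i) => x; case: (s); lia.
have [|||-> _] := @initial_form_factor a `|a i|%N i.
- by rewrite absz_gt0.
- by move=> j; rewrite -e.
- by [].
- by rewrite PoszM e.
Qed.

Lemma in_coneD i s (x y : X) : in_cone i s x -> in_cone i s y -> in_cone i s (x + y).
Proof.
move=> hx hy j; rewrite !ffunE mulrDr; apply: le_trans (ler_normD _ _) _.
exact: lerD.
Qed.

(** Both support functions are superadditive and their sum is additive on the cone, so each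
    superadditivity inequality is an equality there. *)
Lemma min_weight_cone_additive : cone_additive (min_weight T).
Proof.
move=> i s x y cx cy; have := min_weight_sum cx; have := min_weight_sum cy.
have := min_weight_sum (in_coneD cx cy).
have := min_weight_superadditive x y S0; have := min_weight_superadditive x y T0.
rewrite ffunE mulrDr mulrDl.
move: (sgb s * x i * _) (sgb s * y i * _) => m n.
move: (min_weight S _) (min_weight S _) (min_weight S _) => a1 a2 a3.
move: (min_weight T _) (min_weight T _) (min_weight T _) => b1 b2 b3; clear; lia.
Qed.
End Newton.

(** * Zeros of the initial form on a facet *)

Section Degree.
Variables (R : realType) (d : nat) (q : 'I_d -> nat).
Hypotheses (d3 : (3 <= d)%N) (q0 : forall j, (0 < q j)%N).
Hypothesis gcd1 : \big[gcdn/0%N]_(j < d) q j = 1%N.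
Local Notation C := R[i].
Local Notation point := ('I_d -> C).
Local Notation X := {ffun 'I_d -> int}.
Local Notation N := (\prod_j q j)%N.

Definition linear_form (k : point) (w : point) : C := \sum_j k j * w j.

Lemma line_regular_linear_form k : line_regular (linear_form k).
Proof.
apply: line_regular_sum => j; apply: line_regularM; first exact: line_regular_cst.
exact: (line_regular_coordX j 1).
Qed.

Lemma linear_form_neq0 k j0 : k j0 != 0 ->
  exists2 w, torus w & linear_form k w != 0.
Proof.
move=> k0; pose y (x : C) : point := fun j => if j == j0 then x else 1.
have ty x : x != 0 -> torus (y x).
  by move=> x0 j; rewrite /y; case: ifP; rewrite ?oner_neq0.
have E x : linear_form k (y x) = k j0 * x + \sum_(j | j != j0) k j.
  rewrite /linear_form (bigD1 j0) //= /y eqxx; congr (_ + _).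
  by apply: eq_bigr => j /negbTE ->; rewrite mulr1.
have [h|h] := eqVneq (linear_form k (y 1)) 0; last first.
  by exists (y 1); first exact/ty/oner_neq0.
exists (y 2); first by apply: ty; rewrite pnatr_eq0.
move: h; rewrite !E mulr1 => h.
by rewrite mulr_natr mulr2n -addrA h addr0.
Qed.

Definition unity_root_system (rs : forall j : 'I_d, seq C) := forall j,
  [/\ size (rs j) = q j, uniq (rs j) & forall x, x \in rs j -> x ^+ q j = 1].

Lemma unity_root_system_exists : exists rs, unity_root_system rs.
Proof.
have [rs hrs] := fin_all_exists (fun j => unity_roots_exist C (q0 j)).
by exists rs.
Qed.

Section Twists.
Variable rs : forall j : 'I_d, seq C.
Hypothesis rsP : unity_root_system rs.

(** Here [cell q] only serves to index the [N] tuples of [q j]-th roots of unity. *)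
Definition twist (n : cell q) : point := fun j => nth 0 (rs j) (n j).

Lemma twistX n j : twist n j ^+ q j = 1.
Proof. by have [sz _ h] := rsP j; apply: h; apply: mem_nth; rewrite sz ltn_ord. Qed.

Lemma torus_twist n : torus (twist n).
Proof.
move=> j; apply: contraTneq (oner_neq0 C) => e; rewrite -(twistX n j) e.
by rewrite expr0n gtn_eqF // eqxx.
Qed.

(* The twists of the hyperplane [\sum_j w j = 0] are pairwise distinct because
   the q_j have no common factor. *)
Lemma twist_proportional n n' (x : C) : (forall j, twist n j = x * twist n' j) ->
  n = n'.
Proof.
move=> h; have x0 : x != 0.
  have := torus_twist n (Ordinal (leq_trans (isT : (0 < 3)%N) d3)).
  by rewrite h mulf_eq0 negb_or => /andP[].
have x1 : x = 1.
  rewrite -[x]expr1 -gcd1; apply: expr_biggcdn => // j.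
  by have := twistX n j; rewrite h exprMn twistX mulr1.
apply/ffunP => j; apply/val_inj/eqP; have [sz u _] := rsP j.
have /eqP := h j; rewrite x1 mul1r /twist nth_uniq ?sz //; exact: ltn_ord.
Qed.

(** The [i]-th coordinate at which the line through [w] parallel to the [i]-th axis meets the
    hyperplane [\sum_j twist n j * w j = 0]. *)
Definition twist_root i n (w : point) : C :=
  - (\sum_(j | j != i) twist n j * w j) / twist n i.

(** Diagonal pairs give the twisted roots themselves, other pairs their differences. A point where
    no such form vanishes has nonzero, pairwise distinct roots. *)
Definition separating_form i (p : cell q * cell q) : point := fun j =>
  if j == i then 0 else
  if p.1 == p.2 then - twist p.1 j / twist p.1 i
  else - twist p.1 j / twist p.1 i + twist p.2 j / twist p.2 i.

Lemma separating_formE i p w : linear_form (separating_form i p) w =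
  if p.1 == p.2 then twist_root i p.1 w
  else twist_root i p.1 w - twist_root i p.2 w.
Proof.
rewrite /linear_form (bigD1 i) //= /separating_form eqxx mul0r add0r.
have E n : twist_root i n w = \sum_(j | j != i) - twist n j / twist n i * w j.
  rewrite /twist_root mulNr mulr_suml -sumrN; apply: eq_bigr => j _.
  by rewrite !mulNr mulrAC.
rewrite !E; case: eqP => _; first by apply: eq_bigr => j /negbTE ->.
rewrite -sumrB; apply: eq_bigr => j /negbTE ->.
by rewrite mulrDl !mulNr opprK.
Qed.

(** For a pair of distinct twists, a zero form would make them proportional, contradicting
    [twist_proportional]. *)
Lemma separating_form_neq0 i p : exists j, separating_form i p j != 0.
Proof.
have [k /andP[ki _]] := third_index i i d3.
have [e|ne] := eqVneq p.1 p.2.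
  exists k; rewrite /separating_form (negbTE ki) e eqxx mulf_neq0 ?invr_eq0 //.
    by rewrite oppr_eq0; apply: torus_twist.
  exact: torus_twist.
apply: contrapT => none; move/negP: (ne); apply; apply/eqP.
apply: (@twist_proportional _ _ (twist p.1 i / twist p.2 i)) => j.
have [->|ji] := eqVneq j i; first by rewrite divfK // torus_twist.
have := none; apply: contra_notP => /eqP h; exists j.
rewrite /separating_form (negbTE ji) (negbTE ne).
apply: contra h; rewrite addrC mulNr subr_eq0 => /eqP h.
by apply/eqP; rewrite mulrAC -mulrA h mulrC divfK // torus_twist.
Qed.

End Twists.

Variables (T : seq X) (c : X -> C) (uT : uniq T) (T0 : T != [::]).
Hypothesis cT : {in T, forall v, c v != 0}.
Variables (a : X) (i : 'I_d) (lo : int) (beta : nat).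
Hypothesis vanish : forall w, torus w -> \sum_j w j = 0 ->
  initial_form q T c a w = 0.
Hypothesis face_range : forall v, v \in face q T a ->
  lo <= (q i)%:Z * v i <= lo + beta%:Z.

Definition set_coord (w : point) (t : C) : point := fun j => if j == i then t else w j.

(** On the face the exponents of [w i] lie between [lo] and [lo + beta]; factoring out [t ^ lo]
    leaves degree at most [beta]. *)
Lemma initial_form_coord_poly w : torus w -> exists P : {poly C},
  (size P <= beta.+1)%N /\
  forall t, t != 0 -> initial_form q T c a (set_coord w t) = t ^ lo * P.[t].
Proof.
move=> tw.
pose K (v : X) := \prod_(j | j != i) power_point q w j ^ v j.
exists (\sum_(v <- face q T a) (c v * K v) *: 'X^(`|((q i)%:Z * v i - lo)%R|)); split.
  apply: leq_trans (size_sum _ _ _) _; apply/bigmax_leqP_seq => v vf _.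
  apply: leq_trans (size_scale_leq _ _) _; rewrite size_polyXn ltnS.
  by move: (face_range vf); move: (_ * v i) => x; clear; lia.
move=> t t0; rewrite horner_sum mulr_sumr; apply: eq_big_seq => v vf.
rewrite hornerZ hornerXn /zmon (bigD1 i) //= {1}/power_point /set_coord eqxx.
have -> : \prod_(j | j != i) power_point q (fun j => if j == i then t else w j) j ^ v j
          = K v.
  by apply: eq_bigr => j /negbTE ne; rewrite /power_point ne.
have -> : (t ^+ q i) ^ v i = t ^ lo * t ^+ `|((q i)%:Z * v i - lo)%R|.
  rewrite [t ^+ `|_|](_ : _ = t ^ ((q i)%:Z * v i - lo)).
    by rewrite -expfzDr // subrKC -exprz_exp.
  rewrite -{2}[_ - lo]gez0_abs // subr_ge0.
  by case/andP: (face_range vf).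
by move: (t ^ _) (t ^+ _) => x y; ring.
Qed.

Lemma initial_form_degree : (N <= beta)%N.
Proof.
have [rs rsP] := unity_root_system_exists.
(* All genericity conditions in one finite family: [None] stands for the initial form, [Some p] for
   the separating forms. *)
pose F (o : option (cell q * cell q)) : point -> C :=
  if o is Some p then linear_form (separating_form rs i p) else initial_form q T c a.
have [||w tw] := @common_nonzero _ _ _ (enum {: option (cell q * cell q)}) F.
- by case=> [p|]; [apply: line_regular_linear_form | apply: line_regular_power].
- case=> [p|]; last exact: initial_form_neq0.
  by have [j /linear_form_neq0] := separating_form_neq0 rsP i p.
rewrite prodf_seq_neq0 => /allP Fw.
have {}Fw o : F o w != 0 by have := Fw o; rewrite mem_enum => /(_ isT).
have [P [szP hP]] := initial_form_coord_poly tw.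
have P0 : P != 0.
  apply: contraNneq (Fw None) => e /=; have := hP _ (tw i); rewrite e horner0 mulr0.
  suff -> : set_coord w (w i) = w by move=> ->.
  by apply: funext => j; rewrite /set_coord; case: eqP => [->|].
have r0 n : twist_root rs i n w != 0.
  by have := Fw (Some (n, n)); rewrite /F separating_formE eqxx.
have rinj : injective (fun n => twist_root rs i n w).
  move=> n n' e; apply/eqP/negPn/negP => ne.
  by have := Fw (Some (n, n')); rewrite /F separating_formE /= (negbTE ne) e subrr eqxx.
have rP n : root P (twist_root rs i n w).
  set t := twist_root rs i n w.
  have tws : torus (set_coord w t).
    by move=> j; rewrite /set_coord; case: (j == i); [apply: r0 | apply: tw].
  have : initial_form q T c a (set_coord w t) = 0.
    (* The initial form depends on [w] only through the powers [w j ^ q j], so it is invariant under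
       twists; the twisted point lies on [\sum_j w j = 0]. *)
    have <- : initial_form q T c a (fun j => twist rs n j * set_coord w t j) =
              initial_form q T c a (set_coord w t).
      rewrite /initial_form power_pointM; congr (laurent_eval _ _ _).
      by apply: funext => j; rewrite {1}/power_point twistX // mul1r.
    apply: vanish; first by apply: torusM => //; apply: torus_twist.
    rewrite (bigD1 i) //= {1}/set_coord eqxx /t /twist_root mulrC divfK; last first.
      exact: torus_twist.
    rewrite addrC; apply/eqP; rewrite subr_eq0; apply/eqP.
    by apply: eq_bigr => j /negbTE ne; rewrite /set_coord ne.
  rewrite hP; last exact: r0.
  move/eqP; rewrite mulf_eq0 => /orP[|//].
  by rewrite (negbTE (expfz_neq0 _ (r0 n))).
have := max_poly_roots (rs := [seq twist_root rs i n w | n <- enum {: cell q}]) P0.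
rewrite map_inj_uniq // enum_uniq size_map -cardE card_cell => /(_ _ isT) h.
by rewrite -ltnS (leq_trans (h _)) //; apply/allP => x /mapP[n _ ->].
Qed.
End Degree.

(** * Homothetic Newton polytopes and irreducibility *)

Section Main.
Variables (R : realType) (d : nat) (q : 'I_d -> nat).
Hypothesis (q0 : forall j, (0 < q j)%N).
Local Notation C := R[i].
Local Notation point := ('I_d -> C).
Local Notation X := {ffun 'I_d -> int}.
Local Notation N := (\prod_j q j)%N.

(** The values that the support function of [mu] plus [beta] times the cross polytope takes on the
    directions used below. *)
Definition homothetic (T : seq X) (mu : 'I_d -> int) (beta : int) :=
  (forall i b, min_weight q T (signed_unit i b) = sgb b * mu i - beta) /\
  (forall i, min_weight q T [ffun=> -1]
     - min_weight q T ([ffun=> -1] + signed_unit i true + signed_unit i true)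
     = - 2 * mu i).

(** The directions [signed_unit i true] and [signed_unit i false] bound [q i * v i] below by
    [mu i - beta] and above by [mu i + beta]; for [beta <= 0] this pins [v]. *)
Lemma homothetic_le0_singleton T mu beta : uniq T -> T != [::] ->
  homothetic T mu beta -> beta <= 0 -> exists v, T = [:: v].
Proof.
move=> uT T0 [hu _] b0.
have E v : v \in T -> forall i, (q i)%:Z * v i = mu i.
  move=> vT i; have := min_weight_le q (signed_unit i true) vT.
  have := min_weight_le q (signed_unit i false) vT.
  rewrite !hu !weight_unit /sgb; move: (_ * v i) => x; lia.
case: T uT T0 E {hu} => // v T uT _ E; exists v; congr (_ :: _).
case: T uT E => // v' T; rewrite /= inE negb_or -andbA => /andP[/eqP ne _] E.
case: ne; apply/ffunP => i; have q1 : (q i)%:Z != 0 by rewrite gt_eqF // ltz_nat.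
apply: (mulfI q1).
by rewrite !E // !inE eqxx ?orbT.
Qed.

Lemma homothetic_degree T c mu beta : (3 <= d)%N ->
  \big[gcdn/0%N]_(j < d) q j = 1%N ->
  uniq T -> T != [::] -> {in T, forall v, c v != 0} -> homothetic T mu beta ->
  (forall w : point, torus w -> \sum_j w j = 0 ->
     initial_form q T c [ffun=> -1] w = 0) ->
  N%:Z <= beta.
Proof.
move=> d3 gcd1 uT T0 cT [hu hd] vanish.
pose i : 'I_d := Ordinal (leq_trans (isT : (0 < 3)%N) d3).
(* The upper bound comes from the direction [signed_unit i false]. The lower one compares the
   direction with all entries [-1], whose weight is fixed on the face, with the one whose [i]-th
   entry is flipped to [1]. *)
have rng v : v \in face q T [ffun=> -1] -> mu i <= (q i)%:Z * v i <= mu i + beta.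
  rewrite mem_filter => /andP[/eqP e vT].
  have := min_weight_le q (signed_unit i false) vT.
  have := min_weight_le q ([ffun=> -1] + signed_unit i true + signed_unit i true) vT.
  have := hd i; rewrite !hu !weightD !weight_unit -e /sgb.
  move: (_ * v i) (weight _ _ _) (min_weight _ _ _) => x y z; lia.
have b0 : 0 <= beta.
  have := face_neq_nil q [ffun=> -1] T0.
  case: (face _ _ _) rng => // v F /(_ v (mem_head _ _)); lia.
have := @initial_form_degree R d q d3 q0 gcd1 T c uT T0 cT [ffun=> -1] i (mu i) `|beta|%N vanish.
rewrite gez0_abs // => /(_ rng); lia.
Qed.

(** Irreducibility of the hyperplane: the line joining witnesses for the two factors stays inside
    it, and some torus point of that line makes both factors nonzero. *)
Lemma initial_form_hyperplane (S T : seq X) (b c : X -> C) a :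
  (forall w, torus w -> \sum_j w j = 0 ->
     initial_form q S b a w * initial_form q T c a w = 0) ->
  (forall w, torus w -> \sum_j w j = 0 -> initial_form q S b a w = 0) \/
  (forall w, torus w -> \sum_j w j = 0 -> initial_form q T c a w = 0).
Proof.
move=> h; apply: contrapT => /not_orP[hS hT].
have wit (U : seq X) (e : X -> C) :
  ~ (forall w, torus w -> \sum_j w j = 0 -> initial_form q U e a w = 0) ->
  exists w, [/\ torus w, \sum_j w j = 0 & initial_form q U e a w != 0].
  move=> /existsNP[w /not_implyP[tw /not_implyP[sw /eqP nz]]].
  by exists w.
have [x [tx sx nx]] := wit _ _ hS; have [y [ty sy ny]] := wit _ _ hT.
have [s [ts n1 n2]] := line_common_nonzero (line_regular_initial_form _ _ _ _)
  (line_regular_initial_form _ _ _ _) tx ty nx ny.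
have ss : \sum_j affine_line x y s j = 0.
  by rewrite big_split /= -mulr_sumr sumrB sx sy subrr mulr0 addr0.
by have /eqP := h _ ts ss; rewrite mulf_eq0 (negbTE n1) (negbTE n2).
Qed.
End Main.

Lemma singleton_monomial (R : realType) d (f : ('I_d -> R[i]) -> R[i]) v c :
  c v != 0 -> (forall z, torus z -> f z = laurent_eval [:: v] c z) -> is_monomial f.
Proof.
by move=> cv h; exists (c v), v; split=> // z tz; rewrite h // /laurent_eval big_seq1.
Qed.

Theorem mainTheorem4 (R : realType) (d : nat) (q : 'I_d -> nat)
    (V : ('I_d -> int) -> R[i]) :
  (3 <= d)%N ->
  (forall j, (0 < q j)%N) ->
  \big[gcdn/0%N]_(j < d) q j = 1%N ->
  (forall (n : 'I_d -> int) (j : 'I_d),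
      V (fun i => n i + (if i == j then (q j)%:Z else 0)) = V n) ->
  forall lam : R[i],
    ~ (exists f g : ('I_d -> R[i]) -> R[i],
         [/\ is_laurent f, is_laurent g, ~ is_monomial f, ~ is_monomial g &
             forall z, torus z -> floquet_poly q V lam z = f z * g z]).
Proof.
move=> d3 q0 gcd1 _ lam [f [g [lf lg mf mg fact]]].
have [S [b [uS bS fE]]] := is_laurent_normal_form lf.
have [T [c [uT cT gE]]] := is_laurent_normal_form lg.
have factor z : torus z ->
    floquet_poly q V lam z = laurent_eval S b z * laurent_eval T c z.
  by move=> tz; rewrite fact // fE // gE.
have factor' z : torus z ->
    floquet_poly q V lam z = laurent_eval T c z * laurent_eval S b z.
  by move=> tz; rewrite factor // mulrC.
pose i : 'I_d := Ordinal (leq_trans (isT : (0 < 3)%N) d3).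
have [z tz] := floquet_poly_neq0 q0 V lam i.
rewrite factor // mulf_eq0 negb_or => /andP[nS nT].
have S0 : S != [::] by apply: contraNneq nS => ->; rewrite /laurent_eval big_nil.
have T0 : T != [::] by apply: contraNneq nT => ->; rewrite /laurent_eval big_nil.
have addT := min_weight_cone_additive q0 uS uT S0 T0 bS cT factor.
have addS := min_weight_cone_additive q0 uT uS T0 S0 cT bS factor'.
have [muS [betaS homS]] := cone_additive_homothety d3 addS.
have [muT [betaT homT]] := cone_additive_homothety d3 addT.
(* Adding the identities for the two opposite unit directions cancels the translations [muS] and
   [muT]. *)
have sum_beta : betaS + betaT = (\prod_j q j)%N%:Z.
  have cu s : in_cone i s (signed_unit i s).
    by move=> j; rewrite !ffunE eqxx; case: eqP; case: (s).
  have := min_weight_sum q0 uS uT S0 T0 bS cT factor (cu true).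
  have := min_weight_sum q0 uS uT S0 T0 bS cT factor (cu false).
  rewrite !(homS.1, homT.1) !ffunE eqxx /sgb.
  move: (muS i) (muT i) (\prod_j q j)%N => x y n; clear; lia.
have [_ hyp] := @initial_form_factor R d q q0 V lam S T b c uS uT S0 T0 bS cT factor
  [ffun=> -1] 1%N i isT (fun j => ltac:(by rewrite ffunE)) ltac:(by rewrite ffunE).
have [w tw sw|van|van] := @initial_form_hyperplane R d q S T b c [ffun=> -1].
- rewrite hyp //.
  have -> : ([ffun=> -1] : {ffun 'I_d -> int}) = (fun=> -1) :> ('I_d -> int).
    by apply: funext => j; rewrite ffunE.
  exact: initial_mx_singular.
(* Here [betaS >= N], so [sum_beta] leaves [betaT <= 0] and [g] is a monomial; the other case is
   symmetric. *)
- have le := homothetic_degree q0 d3 gcd1 uS S0 bS homS van.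
  have [|v eT] := homothetic_le0_singleton q0 uT T0 homT.
    by move: sum_beta le; clear; lia.
  apply: mg; apply: (@singleton_monomial _ _ _ v c); last by rewrite -eT.
  by apply: cT; rewrite eT mem_head.
- have le := homothetic_degree q0 d3 gcd1 uT T0 cT homT van.
  have [|v eS] := homothetic_le0_singleton q0 uS S0 homS.
    by move: sum_beta le; clear; lia.
  apply: mf; apply: (@singleton_monomial _ _ _ v b); last by rewrite -eS.
  by apply: bS; rewrite eS mem_head.
Qed.
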